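(* Let $X$ be a topological space, $Z$ a metrizable space, $Z_1\subseteq Z$ a subset which is equiconnected in $Z$, and $g:X\to Z$ a mapping for which there exists a sequence of continuous functions $g_n:X\to Z_1$ converging to $g$ pointwise on $X$. Then there exists a separately continuous mapping $f:X^2\to Z$ with diagonal $g$, that is, with $f(x,x)=g(x)$ for every $x\in X$.
   Context: A mapping defined on $X^2=X\times X$ is separately continuous if it is continuous with respect to each of its two variables when the other one is fixed. The diagonal of $f:X^2\to Z$ is the mapping $x\mapsto f(x,x)$. For a topological space $Z$ put $\Delta=\{(z,z):z\in Z\}$. A set $A\subseteq Z$ is called equiconnected in $Z$ if there exists a continuous mapping $\lambda:((A\times A)\cup\Delta)\times[0,1]\to Z$ (the domain carrying the subspace topology from $Z\times Z\times[0,1]$) such that (i) $\lambda(A\times A\times[0,1])\subseteq A$; (ii) $\lambda(x,y,0)=\lambda(y,x,1)=x$ for all $x,y\in A$; (iii) $\lambda(z,z,t)=z$ for all $z\in Z$ and $t\in[0,1]$. *)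

(* Defs.v *)
From HB Require Import structures.
From mathcomp Require Import all_boot all_order all_algebra.
From mathcomp Require Import all_classical reals topology.

Set Implicit Arguments.
Unset Strict Implicit.
Unset Printing Implicit Defensive.

Import Order.TTheory GRing.Theory Num.Theory.
Import numFieldTopology.Exports.

Local Open Scope classical_set_scope.
Local Open Scope ring_scope.

Definition is_metric (R : realType) (Z : Type) (d : Z -> Z -> R) : Prop :=
  [/\ forall x y, 0 <= d x y,
      forall x y, d x y = 0 <-> x = y,
      forall x y, d x y = d y x &
      forall x y z, d x z <= d x y + d y z].

(* The given topology of Z is that of some metric: the balls around each
   point form a base of its neighbourhood filter. *)
Definition metrizable (R : realType) (Z : topologicalType) : Prop :=
  exists d : Z -> Z -> R, is_metric d /\
    forall (z : Z) (U : set Z),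
      nbhs z U <-> exists2 e : R, 0 < e & [set w | d z w < e] `<=` U.

Lemma metrizable_metricType (R : realType) (Z : metricType R) :
  metrizable R Z.
Proof.
exists mdist; split.
  split=> [x y|x y|x y|x y z].
  - exact: mdist_ge0.
  - by split=> [/mdist_positivity //|->]; rewrite mdistxx.
  - exact: metric_sym.
  - exact: metric_triangle.
by move=> z U; rewrite -metricType_numDomainType.filter_from_mdist_nbhs.
Qed.

Definition separately_continuous (X Y Z : topologicalType) (f : X * Y -> Z) :
    Prop :=
  (forall x, continuous (fun y => f (x, y))) /\
  (forall y, continuous (fun x => f (x, y))).

Definition equiconnected_dom (R : realType) (Z : topologicalType)
    (A : set Z) : set (Z * Z * R) :=
  (A `*` A `|` diagonal) `*` `[0, 1].

(* lambda is a total function on Z * Z * R; only its values on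
   equiconnected_dom A matter, since [{within D, continuous _}] is continuity
   of the restriction to D for the subspace topology. *)
Definition equiconnected_in (R : realType) (Z : topologicalType)
    (A : set Z) : Prop :=
  exists lambda : Z * Z * R -> Z,
  [/\ {within equiconnected_dom A, continuous lambda},
      lambda @` (A `*` A `*` `[0, 1]) `<=` A,
      forall x y, A x -> A y -> lambda (x, y, 0) = x /\ lambda (y, x, 1) = x &
      forall z t, `[0, 1]%classic t -> lambda (z, z, t) = z].

Arguments equiconnected_in R {Z} A.

(* Main.v *)
(** Let [d] be a metric of [Z]. Starting from [gn 0 x], set
    [H (n+1) (x, y) = lambda (H n (x, y), gn (n+1) x, theta n (x, y))], where
    the continuous cutoff [theta n] is [0] unless [gn 0, ..., gn (n+1)] all
    vary by less than [2^(1-n)] between [x] and [y], and where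
    [theta (n+1) <> 0] forces [theta n = 1]. If some [theta n] vanishes at
    [(x, y)], the sequence [H n] is stationary near [(x, y)], so its limit [f]
    is continuous there. Otherwise [gn n x = gn n y] for all [n], and
    [f (x, y) = g x = g y]; near such a point [f (x', y')] is either [g x'] or
    [lambda (gn i x', gn j x', t)] with [i], [j] large and with [gn i x'],
    [gn j x'] close to [gn i y'], [gn j y']. If [x' = x] or [y' = y], both are
    close to [g x], and [lambda (z, z, t) = z] together with the compactness of
    [[0, 1]] gives continuity of the sections. *)
Require Import Defs.
From mathcomp Require Import all_boot all_order all_algebra.
From mathcomp Require Import all_classical reals topology.
From mathcomp Require Import normedtype lra.

Set Implicit Arguments.
Unset Strict Implicit.
Unset Printing Implicit Defensive.

Import Order.TTheory GRing.Theory Num.Theory.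
Import numFieldNormedType.Exports.

Local Open Scope classical_set_scope.
Local Open Scope ring_scope.

(** * Continuity tools and a tube argument around the diagonal *)

Lemma metric_continuous (R : realType) (Z T : topologicalType)
    (d : Z -> Z -> R) (u v : T -> Z) :
  is_metric d ->
  (forall (z : Z) (U : set Z),
    nbhs z U <-> exists2 e : R, 0 < e & [set w | d z w < e] `<=` U) ->
  continuous u -> continuous v -> continuous (fun p => d (u p) (v p)).
Proof.
move=> [_ _ dsym dtri] dnbhs cu cv p.
have near_small (w : T -> Z) e : continuous w -> 0 < e ->
    \forall q \near p, d (w p) (w q) < e.
  by move=> cw e0; apply: (cw p [set w' | d (w p) w' < e]); apply/dnbhs; exists e.
apply/cvgrPdist_lt => e e0; near=> q.
have du : d (u p) (u q) < e / 2.
  by near: q; apply: near_small => //; rewrite divr_gt0.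
have dv : d (v p) (v q) < e / 2.
  by near: q; apply: near_small => //; rewrite divr_gt0.
have := dtri (u p) (u q) (v p); have := dtri (u q) (v q) (v p).
have := dtri (u q) (u p) (v q); have := dtri (u p) (v p) (v q).
rewrite (dsym (v q) (v p)) (dsym (u q) (u p)) => *.
by rewrite ltr_norml; apply/andP; split; lra.
Unshelve. all: by end_near. Qed.

Lemma continuous_pair (S T U : topologicalType) (u : S -> T) (v : S -> U) :
  continuous u -> continuous v -> continuous (fun s => (u s, v s)).
Proof.
move=> cu cv s.
exact: (@cvg_pair _ _ _ _ (nbhs (u s)) (nbhs (v s)) _ _ _ u v (cu s) (cv s)).
Qed.

Lemma within_continuous_compose (S T U : topologicalType) (D : set T)
    (f : T -> U) (h : S -> T) :
  {within D, continuous f} -> continuous h -> (forall s, D (h s)) ->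
  continuous (f \o h).
Proof.
move=> /subspace_continuousP cf ch Dh s V fV.
have : nbhs s (h @^-1` [set t | D t -> V (f t)]) := ch s _ (cf _ (Dh s) V fV).
by apply: filterS => s' /(_ (Dh s')).
Qed.

(** Tube lemma: [lambda] sends the whole segment over [(z, z)] to [z], so each [t] has a good
    neighbourhood, and compactness of [[0, 1]] gives one that serves all [t] at once. *)
Lemma equiconnected_near_diagonal (R : realType) (Z : topologicalType)
    (A : set Z) (lambda : Z * Z * R -> Z) (z : Z) (U : set Z) :
  {within equiconnected_dom A, continuous lambda} ->
  (forall t, `[0, 1]%classic t -> lambda (z, z, t) = z) ->
  nbhs z U ->
  exists2 V, nbhs z V & forall a b t, A a -> A b -> V a -> V b ->
    `[0, 1]%classic t -> U (lambda (a, b, t)).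
Proof.
move=> /subspace_continuousP clam lamz Uz.
pose P (ab : Z * Z) (t : R) :=
  A ab.1 -> A ab.2 -> `[0, 1]%classic t -> U (lambda (ab, t)).
have : \forall ab \near (z, z), `[0, 1]%classic `<=` P ab.
  have /compact_near_coveringP cover := @segment_compact R 0 1.
  apply: (cover _ (nbhs (z, z)) P) => t It.
  have Dt : equiconnected_dom A (z, z, t) by split=> //; right.
  have Ut : nbhs (lambda (z, z, t)) U by rewrite lamz.
  have := clam _ Dt _ Ut => -[[Vz Vt] [/= Vznbhs Vtnbhs] VU].
  exists (Vt, Vz) => //= -[s ab] [/= Vts Vzab] Aa Ab Is.
  case: ab Vzab Aa Ab => a b Vzab Aa Ab.
  by apply: (VU (a, b, s)) => //; split=> //; left.
move=> -[[V W] [Vz Wz] VW]; exists (V `&` W); first exact: filterI.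
move=> a b t Aa Ab [Va _] [_ Wb] It.
by apply: (VW (a, b)) => //; split.
Qed.

(** * Iterated interpolation along [lambda] and its stationary limit *)

Fixpoint staircase (R : realType) (T Z : Type) (lambda : Z * Z * R -> Z)
    (h : nat -> T -> Z) (theta : nat -> T -> R) (n : nat) (p : T) : Z :=
  if n is m.+1 then lambda (staircase lambda h theta m p, h m.+1 p, theta m p)
  else h 0 p.

Section staircase.
Variables (R : realType) (Z T : topologicalType) (A : set Z).
Variables (lambda : Z * Z * R -> Z) (h : nat -> T -> Z) (theta : nat -> T -> R).
Hypothesis lam_A : lambda @` (A `*` A `*` `[0, 1]) `<=` A.
Hypothesis lam_ends :
  forall x y, A x -> A y -> lambda (x, y, 0) = x /\ lambda (y, x, 1) = x.
Hypothesis h_A : forall n p, A (h n p).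
Hypothesis theta01 : forall n p, `[0, 1]%classic (theta n p).

Local Notation H := (staircase lambda h theta).

Lemma staircase_in n p : A (H n p).
Proof.
elim: n => [|n IHn] /=; first exact: h_A.
apply: lam_A; exists (H n p, h n.+1 p, theta n p) => //.
split; last exact: theta01.
by split; [exact: IHn|exact: h_A].
Qed.

Lemma staircase_continuous n :
  {within equiconnected_dom A, continuous lambda} ->
  (forall k, continuous (h k)) -> (forall k, continuous (theta k)) ->
  continuous (H n).
Proof.
move=> clam ch ctheta; elim: n => [|n IHn] /=; first exact: ch.
apply: (within_continuous_compose
  (h := fun p => (H n p, h n.+1 p, theta n p)) clam) => [|p].
  by do 2?apply: continuous_pair.
by split; [left; split; [exact: staircase_in|exact: h_A]|exact: theta01].
Qed.

Lemma staircase_theta1 n p : theta n p = 1 -> H n.+1 p = h n.+1 p.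
Proof.
by move=> /= ->; case: (lam_ends (h_A n.+1 p) (staircase_in n p)).
Qed.

Lemma staircase_theta0 n p : theta n p = 0 -> H n.+1 p = H n p.
Proof.
by move=> /= ->; case: (lam_ends (staircase_in n p) (h_A n.+1 p)).
Qed.

Hypothesis theta_cascade : forall n p, theta n.+1 p <> 0 -> theta n p = 1.

(** A zero propagates upwards: a nonzero [theta n.+1 p] would force [theta n p] to be 1. *)
Lemma staircase_stable n m p : theta n p = 0 -> (n <= m)%N -> H m p = H n p.
Proof.
move=> tn /subnK <-; suff [] : theta (m - n + n) p = 0 /\ H (m - n + n) p = H n p.
  by [].
elim: (m - n)%N => [//|k [tk Hk]]; rewrite addSn; split; last first.
  by rewrite staircase_theta0.
have [//|/eqP/theta_cascade tk1] := eqVneq (theta (k + n).+1 p) 0.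
by move/eqP: tk; rewrite tk1 oner_eq0.
Qed.

(** No limit in [Z] is taken: [f p] is the stationary value if some [theta n p] vanishes, and [g p]
    otherwise. By [theta_cascade] the second case means that every [theta n p] is 1. *)
Lemma staircase_limit (g : T -> Z) : exists f : T -> Z,
  (forall n p, theta n p = 0 -> f p = H n p) /\
  (forall p, (forall n, theta n p = 1) -> f p = g p).
Proof.
suff /choice[f fP] : forall p, exists z,
    (forall n, theta n p = 0 -> z = H n p) /\
    ((forall n, theta n p = 1) -> z = g p).
  by exists f; split => [n p|p]; [exact: (fP p).1|exact: (fP p).2].
move=> p; have [[n tn]|no0] := pselect (exists n, theta n p = 0).
  exists (H n p); split => [m tm|/(_ n)/eqP]; last by rewrite tn eq_sym oner_eq0.
  have [nm|/ltnW mn] := leqP n m; first by rewrite (staircase_stable tn nm).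
  exact: staircase_stable tm mn.
by exists (g p); split=> // n tn; case: no0; exists n.
Qed.

(** Let [k.+1] be the first index where [theta] is not 1. Then [theta k p = 1] resets the staircase
    to [h k.+1 p], and [theta k.+2 p = 0] stops it, so at most one interpolation, between [h k.+1 p]
    and [h k.+2 p], remains. *)
Lemma staircase_limit_shape f m p :
  (forall n p, theta n p = 0 -> f p = H n p) -> theta m p = 1 ->
  (forall n, theta n p = 1) \/
  exists i j t, [/\ (m <= i)%N /\ (m <= j)%N, theta i p <> 0, theta j p <> 0,
    `[0, 1]%classic t & f p = lambda (h i.+1 p, h j.+1 p, t)].
Proof.
move=> fH tm; have [?|no1] := pselect (forall n, theta n p = 1); first by left.
right; have ex1 : exists n, theta n p != 1.
  by apply: contrapT => no; apply: no1 => n; apply/eqP/negPn/negP => tn;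
    apply: no; exists n.
have tone n : theta n p = 1 -> theta n p <> 0.
  by move=> ->; apply/eqP; rewrite oner_eq0.
have down k n : theta (k + n)%N p = 1 -> theta n p = 1.
  by elim: k => // k IHk; rewrite addSn => /tone/theta_cascade/IHk.
case: (ex_minnP ex1) => n tn nmin.
have mn : (m < n)%N.
  rewrite ltnNge; apply/negP => /subnK nm; move: tm.
  by rewrite -nm => /down/eqP; apply/negP.
case: n => [//|k] in tn nmin mn *.
have tk : theta k p = 1.
  by apply/eqP/negPn/negP => /nmin; rewrite ltnn.
have tk2 : theta k.+2 p = 0.
  have [//|/eqP/theta_cascade/eqP] := eqVneq (theta k.+2 p) 0.
  by rewrite (negbTE tn).
have [t0|/eqP t0] := eqVneq (theta k.+1 p) 0.
  (* The index [k.+1] is excluded since its [theta] vanishes; the single value [h k.+1 p] is written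
     as the start of a path from itself to itself. *)
  exists k, k, 0; split; [by []|exact: tone|exact: tone| |].
    by rewrite /= in_itv /= lexx ler01.
  rewrite (fH _ _ t0) staircase_theta1//.
  by case: (lam_ends (h_A k.+1 p) (h_A k.+1 p)).
exists k, k.+1, (theta k.+1 p); split; [|exact: tone|by []|exact: theta01|].
  by split => //; exact: leq_trans (leqnSn _).
by rewrite (fH _ _ tk2) -(staircase_theta1 tk).
Qed.

Lemma staircase_limit_continuous f n p :
  {within equiconnected_dom A, continuous lambda} ->
  (forall k, continuous (h k)) -> (forall k, continuous (theta k)) ->
  (forall n p, theta n p = 0 -> f p = H n p) ->
  (\forall q \near p, theta n q = 0) -> {for p, continuous f}.
Proof.
move=> clam ch ctheta fH near0.
have Hf : \forall q \near p, H n q = f q by apply: filterS near0 => q /fH.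
have cH : H n q @[q --> p] --> f p.
  by rewrite -(nbhs_singleton Hf); exact: staircase_continuous.
exact: (cvg_trans (near_eq_cvg Hf) cH).
Qed.

End staircase.

(** * Cutoff functions built from the metric *)

Section cutoff.
Variables (R : realType) (X Z : topologicalType) (d : Z -> Z -> R).
Variables (gn : nat -> X -> Z).
Hypothesis d_metric : is_metric d.

(** The sum runs up to [k = n.+1] because [theta n] governs the step towards [h n.+1]. *)
Definition cumulative_dist (n : nat) (p : X * X) : R :=
  \sum_(k < n.+2) d (gn k p.1) (gn k p.2).

Definition cutoff (n : nat) (p : X * X) : R :=
  Num.min 1 (Num.max 0 (2 - 2 ^+ n * cumulative_dist n p)).

Lemma cutoff_itv n p : `[0, 1]%classic (cutoff n p).
Proof.
by rewrite /= in_itv /= le_min ler01 le_max lexx ge_min lexx.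
Qed.

Lemma cumulative_dist_ge n k p :
  (k <= n.+1)%N -> d (gn k p.1) (gn k p.2) <= cumulative_dist n p.
Proof.
case: d_metric => d0 _ _ _ kn.
rewrite /cumulative_dist (bigD1 (Ordinal (kn : (k < n.+2)%N))) //=.
by rewrite lerDl; exact: sumr_ge0.
Qed.

Lemma cumulative_dist_step n p :
  2 * (2 ^+ n * cumulative_dist n p) <= 2 ^+ n.+1 * cumulative_dist n.+1 p.
Proof.
case: d_metric => d0 _ _ _.
rewrite mulrA -exprS ler_wpM2l ?exprn_ge0//.
by rewrite /cumulative_dist [leRHS]big_ord_recr /= lerDl.
Qed.

Lemma cutoff_neq0 n p :
  cutoff n p <> 0 -> 2 ^+ n * cumulative_dist n p < 2.
Proof.
move=> c0; rewrite ltNge; apply/negP => c2; apply: c0.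
rewrite /cutoff (max_idPl _) ?subr_le0//.
by apply/min_idPr.
Qed.

Lemma cutoff_eq1 n p : 2 ^+ n * cumulative_dist n p <= 1 -> cutoff n p = 1.
Proof.
move=> c1; apply/min_idPl; rewrite le_max; apply/orP; right.
by lra.
Qed.

(** The weighted sum at least doubles from [n] to [n.+1], so being below the threshold 2 at [n.+1]
    puts it below the threshold 1 at [n]. *)
Lemma cutoff_cascade n p : cutoff n.+1 p <> 0 -> cutoff n p = 1.
Proof.
move=> /cutoff_neq0 c2; apply: cutoff_eq1.
by have := cumulative_dist_step n p; lra.
Qed.

Lemma cutoff_dist n k p : (k <= n.+1)%N -> cutoff n p <> 0 ->
  2 ^+ n * d (gn k p.1) (gn k p.2) < 2.
Proof.
move=> kn /cutoff_neq0; apply: le_lt_trans.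
by rewrite ler_wpM2l ?exprn_ge0 ?cumulative_dist_ge.
Qed.

Lemma cutoff_all1 k p : (forall n, cutoff n p = 1) -> gn k p.1 = gn k p.2.
Proof.
case: (d_metric) => d0 dE _ _ c1; apply/dE/eqP.
rewrite eq_le d0 andbT leNgt; apply/negP => dk0.
set D := d _ _ in dk0.
pose n := (k + (Num.bound (2 / D)))%N.
have : 2 ^+ n * D < 2.
  apply: cutoff_dist; first by rewrite /n -addnS leq_addr.
  by rewrite c1; apply/eqP; rewrite oner_eq0.
apply/negP; rewrite -leNgt -ler_pdivrMr//.
have /archi_boundP/ltW/le_trans : 0 <= 2 / D by rewrite divr_ge0 ?ler0n ?ltW.
apply; rewrite -natrX ler_nat.
by rewrite (leq_trans (leq_addl k _))// ltnW// ltn_expl.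
Qed.

Hypothesis dnbhs : forall (z : Z) (U : set Z),
  nbhs z U <-> exists2 e : R, 0 < e & [set w | d z w < e] `<=` U.
Hypothesis gn_continuous : forall n, continuous (gn n).

Lemma cumulative_dist_continuous n : continuous (cumulative_dist n).
Proof.
move=> p; apply: cvg_big => [|k _]; first exact: add_continuous.
apply: (metric_continuous (u := gn k \o fst) (v := gn k \o snd)) => // q.
  by apply: continuous_comp; [exact: cvg_fst|exact: gn_continuous].
by apply: continuous_comp; [exact: cvg_snd|exact: gn_continuous].
Qed.

Lemma scaled_dist_continuous n :
  continuous (fun p => 2 ^+ n * cumulative_dist n p).
Proof. by move=> p; apply: cvgMl_tmp; exact: cumulative_dist_continuous. Qed.

Lemma cutoff_continuous n : continuous (cutoff n).
Proof.
move=> p; pose c (t : R) : X * X -> R^o := fun=> t.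
have cc t : {for p, continuous (c t)} by exact: cvg_cst.
apply: (continuous_min (cc 1)); apply: (continuous_max (cc 0)).
by apply: cvgB; [exact: cvg_cst|exact: scaled_dist_continuous].
Qed.

(** Vanishing at [n] is only a closed condition, but doubling turns the bound 2 into 4, and
    exceeding 2 strictly is open. *)
Lemma cutoff_near0 n p : cutoff n p = 0 -> \forall q \near p, cutoff n.+1 q = 0.
Proof.
move=> c0.
have c2 : 2 <= 2 ^+ n * cumulative_dist n p.
  rewrite leNgt; apply/negP => c2; move/eqP: c0.
  rewrite /cutoff gt_eqF// lt_min ltr01 lt_max.
  by apply/orP; right; rewrite subr_gt0.
have c4 : 2 < 2 ^+ n.+1 * cumulative_dist n.+1 p.
  by have := cumulative_dist_step n p; lra.
have cs : 2 ^+ n.+1 * cumulative_dist n.+1 q @[q --> p]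
    --> 2 ^+ n.+1 * cumulative_dist n.+1 p by exact: scaled_dist_continuous.
have near2 : \forall q \near p, 2 < 2 ^+ n.+1 * cumulative_dist n.+1 q.
  exact: (cvgr_gt _ cs).
apply: filterS near2 => q cq.
rewrite /cutoff (max_idPl _) ?subr_le0 ?ltW//.
by apply/min_idPr.
Qed.

End cutoff.

Theorem corollary2p2 (R : realType) (X Z : topologicalType) (Z1 : set Z)
    (g : X -> Z) :
  metrizable R Z ->
  equiconnected_in R Z1 ->
  (exists gn : nat -> X -> Z,
    (forall n, continuous (gn n) /\ (forall x, Z1 (gn n x))) /\
    (forall x, gn n x @[n --> \oo] --> g x)) ->
  exists f : X * X -> Z,
    separately_continuous f /\ (forall x, f (x, x) = g x).
Proof.
move=> [d [dm dnbhs]] [lambda [clam lamA lamE lamD]] [gn [gnP gng]].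
have gnc n := (gnP n).1; have gnZ n := (gnP n).2.
have [d0 dE dsym dtri] := dm.
pose h n (p : X * X) := gn n p.1; pose theta := cutoff d gn.
have hZ n p : Z1 (h n p) by exact: gnZ.
have hc n : continuous (h n).
  by move=> p; apply: continuous_comp; [exact: cvg_fst|exact: gnc].
have tc n : continuous (theta n) by exact: cutoff_continuous.
have t01 n p : `[0, 1]%classic (theta n p) by exact: cutoff_itv.
have casc n p : theta n.+1 p <> 0 -> theta n p = 1 by exact: cutoff_cascade.
have [f [f0 f1]] :=
  staircase_limit lamA lamE hZ t01 casc (fun p : X * X => g p.1).
(* Uniqueness of limits: the sequences [gn n p.1] and [gn n p.2] coincide here. *)
have f1g p : (forall n, theta n p = 1) -> g p.1 = g p.2.
  move=> t1; apply/dE/eqP; rewrite eq_le d0 andbT; apply/ler_addgt0Pr => e e0.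
  have e2 : 0 < e / 2 by rewrite divr_gt0.
  have near_lim x : \forall n \near \oo, d (g x) (gn n x) < e / 2.
    by apply: (gng x [set w | d (g x) w < e / 2]); apply/dnbhs; exists (e / 2).
  near \oo => n; rewrite add0r.
  have := dtri (g p.1) (gn n p.1) (g p.2).
  rewrite {2}(cutoff_all1 dm n t1) (dsym (gn n p.2)).
  have : d (g p.1) (gn n p.1) < e / 2 by near: n; exact: near_lim.
  have : d (g p.2) (gn n p.2) < e / 2 by near: n; exact: near_lim.
  lra.
(* Convergence is only pointwise, hence the restriction to the cross through [p0]. If [p.1 = p0.1],
   convergence at [p0.1] suffices; if [p.2 = p0.2], a nonzero cutoff puts [gn n.+1 p.1] near
   [gn n.+1 p0.2 = gn n.+1 p0.1]. *)
have cross p0 : (forall n, theta n p0 = 1) -> forall U, nbhs (f p0) U ->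
    \forall p \near p0, p.1 = p0.1 \/ p.2 = p0.2 -> U (f p).
  move=> t1 U; rewrite (f1 _ t1) => Uz.
  have [V /dnbhs[e e0 eV] VU] :=
    equiconnected_near_diagonal clam (lamD (g p0.1)) Uz.
  have e2 : 0 < e / 2 by rewrite divr_gt0.
  have [M _ gM] : \forall n \near \oo, d (g p0.1) (gn n p0.1) < e / 2.
    apply: (gng p0.1 [set w | d (g p0.1) w < e / 2]).
    by apply/dnbhs; exists (e / 2).
  (* [M] controls the convergence at [p0.1]; the other summand brings the cutoff bound [2 / 2 ^+ n]
     below [e / 2]. *)
  pose m := (M + Num.bound (2 / (e / 2)))%N.
  have em n : (m <= n)%N -> 2 <= 2 ^+ n * (e / 2).
    move=> mn; rewrite -ler_pdivrMr//.
    have /archi_boundP/ltW/le_trans : 0 <= 2 / (e / 2) by rewrite divr_ge0// ltW.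
    apply; rewrite -natrX ler_nat.
    apply: (@leq_trans n); last by rewrite ltnW// ltn_expl.
    by apply: leq_trans mn; rewrite leq_addl.
  have V_gn n p : p.1 = p0.1 \/ p.2 = p0.2 -> (m <= n)%N -> theta n p <> 0 ->
      V (gn n.+1 p.1).
    move=> pE mn tn; apply: eV => /=.
    have gMn : d (g p0.1) (gn n.+1 p0.1) < e / 2.
      apply: gM => /=.
      exact: leq_trans (leq_addr _ _) (leq_trans mn (leqnSn n)).
    case: pE => [->|p2]; first by lra.
    have := cutoff_dist dm (leqnn _) tn; rewrite p2 -(cutoff_all1 dm n.+1 t1).
    move=> /lt_le_trans/(_ (em n mn)); rewrite ltr_pM2l ?exprn_gt0//.
    rewrite dsym; have := dtri (g p0.1) (gn n.+1 p0.1) (gn n.+1 p.1).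
    lra.
  (* Positivity is an open condition, unlike being equal to 1; the cascade then yields
     [theta m p = 1] exactly, one index lower. *)
  have theta_gt0 : \forall p \near p0, 0 < theta m.+1 p.
    have ct : theta m.+1 p @[p --> p0] --> theta m.+1 p0 by exact: tc.
    by apply: (cvgr_gt _ ct); rewrite t1 ltr01.
  apply: filterS theta_gt0 => p /lt0r_neq0/eqP/casc tm pE.
  have [p1|[i [j [t [[mi mj] ti tj It ->]]]]] :=
    staircase_limit_shape lamA lamE hZ t01 casc f0 tm.
    rewrite (f1 _ p1); suff -> : g p.1 = g p0.1 by exact: nbhs_singleton.
    by case: pE => [->//|p2]; rewrite (f1g _ p1) p2 (f1g _ t1).
  by apply: VU => //; exact: V_gn.
have sect p : {for p, continuous f} \/ forall U, nbhs (f p) U ->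
    \forall q \near p, q.1 = p.1 \/ q.2 = p.2 -> U (f q).
  have [[n tn]|no0] := pselect (exists n, theta n p = 0).
    left; apply: (staircase_limit_continuous (n := n.+1) lamA hZ t01 clam) => //.
    exact: cutoff_near0.
  right; apply: cross => n; apply: casc => tn; apply: no0; by exists n.+1.
exists f; split; last first.
  (* On the diagonal all distances are 0, so every cutoff is 1. *)
  move=> x; apply: (f1 (x, x)) => n; apply: cutoff_eq1.
  rewrite /cumulative_dist big1 ?mulr0 ?ler01// => k _.
  exact/dE.
split=> [x y|y x] U Uf.
  have cp : continuous (fun y : X => (x, y)).
    by apply: continuous_pair => ?; [exact: cvg_cst|exact: cvg_id].
  have [fc|fU] := sect (x, y); first exact: (cp y _ (fc U Uf)).
  have : nbhs y ((fun y => (x, y)) @^-1` _) := cp y _ (fU U Uf).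
  by apply: filterS => y'; apply; left.
have cp : continuous (fun x : X => (x, y)).
  by apply: continuous_pair => ?; [exact: cvg_id|exact: cvg_cst].
have [fc|fU] := sect (x, y); first exact: (cp x _ (fc U Uf)).
have : nbhs x ((fun x => (x, y)) @^-1` _) := cp x _ (fU U Uf).
by apply: filterS => x'; apply; right.
Unshelve. all: by end_near. Qed.
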